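(* For each $n$ let $\delta$ be a uniformly random transition function of an automaton with state set $[n]$ and alphabet $\{a,b\}$. Let $k:=\lceil 2\sqrt{n\ln n}\rceil$ and let $A:=\delta_{a^k}([n])$ be the set of states that can be reached by performing $k$ $a$-transitions in a row. Then, as $n\to\infty$, $$\mathbb{E}[|A|]\le (1+o(1))\sqrt{2\pi n}.$$
   Context: $[n]=\{1,\dots,n\}$. A random automaton on state set $[n]$ with alphabet $\{a,b\}$ is given by a transition function $\delta:[n]\times\{a,b\}\to[n]$ chosen uniformly among all $n^{2n}$ such functions; equivalently, the values $\delta_c(x):=\delta(x,c)$, for $x\in[n]$, $c\in\{a,b\}$, are independent and uniform on $[n]$. For a word $\omega=\omega_1\omega_2\cdots\omega_m\in\{a,b\}^*$ put $\delta_\omega:=\delta_{\omega_m}\circ\cdots\circ\delta_{\omega_1}$, and for $B\subseteq[n]$ put $\delta_\omega(B):=\{\delta_\omega(x):x\in B\}$. The word $a^k$ is the letter $a$ repeated $k$ times. *)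

(* Defs.v *)
From HB Require Import structures.
From mathcomp Require Import all_boot all_order all_algebra.
From mathcomp Require Import all_classical all_reals all_analysis.
Import Order.TTheory GRing.Theory Num.Theory.
Import numFieldNormedType.Exports.

Set Implicit Arguments.
Unset Strict Implicit.
Unset Printing Implicit Defensive.

Local Open Scope ring_scope.

Definition letter : finType := bool.
Definition letter_a : letter := false.
Definition letter_b : letter := true.

(* States are numbered 0, ..., n-1 instead of 1, ..., n. *)
Definition automaton (n : nat) : finType := {ffun 'I_n * letter -> 'I_n}.

(* [foldl] reads the word from left to right: the first letter acts first. *)
Definition delta_word (n : nat) (delta : automaton n) (w : seq letter)
    (x : 'I_n) : 'I_n :=
  foldl (fun y c => delta (y, c)) x w.

Definition delta_set (n : nat) (delta : automaton n) (w : seq letter)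
    (B : {set 'I_n}) : {set 'I_n} :=
  [set delta_word delta w x | x in B].

(* Expectation of [X] under the uniform distribution on the finite type [T]. *)
Definition unif_expectation (R : realType) (T : finType) (X : T -> R) : R :=
  (\sum_(t : T) X t) / #|T|%:R.

(* The argument of the ceiling is nonnegative, so the absolute value only
   converts from [int] to [nat]. *)
Definition k_of (R : realType) (n : nat) : nat :=
  `|Num.ceil (2 * Num.sqrt (n%:R * ln (n%:R : R)))|%N.

Definition a_reachable (R : realType) (n : nat) (delta : automaton n)
    : {set 'I_n} :=
  delta_set delta (nseq (k_of R n) letter_a) [set: 'I_n].

(* Main.v *)
(** Let f be the action of the letter a. A state f^k z either is cyclic or comes
    from a z whose path z, f z, ..., f^k z has no repetition. The probability u_j
    that x, ..., f^j x are distinct satisfies u_(j+1) = u_j (1 - (j+1)/n), and x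
    lies on a cycle of length j+1 with probability u_j / n. The choice of k gives
    u_k <= exp (- k^2 / 2n) <= n^-2, so the second kind contributes at most 1. The
    expected number of cyclic states is the sum of the u_j. It is asymptotic to
    sqrt (pi n / 2), half of the claimed bound, so the crude estimate
    2 sqrt n <= sqrt (2 pi n) is enough. *)

Require Import Defs.
From mathcomp Require Import all_boot all_order all_algebra.
From mathcomp Require Import all_classical all_reals all_analysis.
From mathcomp Require Import ring lra.
Import Order.TTheory GRing.Theory Num.Theory.
Import numFieldNormedType.Exports.
Local Open Scope ring_scope.

Set Implicit Arguments.
Unset Strict Implicit.
Unset Printing Implicit Defensive.

(** * Resampling one value of a random function, and iterates that repeat *)

Definition ffun_update (D T : finType) (f : {ffun D -> T}) (d : D) (y : T) :
    {ffun D -> T} :=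
  [ffun z => if z == d then y else f z].

(* Swapping the value of f at p f with an independent y is an involution of the
   pairs (f, y) with f in U, so f (p f) is uniform given U. *)
Lemma card_resample (D T : finType) (U : pred {ffun D -> T})
    (p : {ffun D -> T} -> D) (S : {ffun D -> T} -> pred T) :
  (forall f y, U f -> U (ffun_update f (p f) y)) ->
  (forall f y, U f -> p (ffun_update f (p f) y) = p f) ->
  (forall f y, U f -> S (ffun_update f (p f) y) =1 S f) ->
  (#|T| * #|[pred f | U f && S f (f (p f))]| = \sum_(f | U f) #|S f|)%N.
Proof.
move=> UU pU SU.
pose h (q : {ffun D -> T} * T) := (ffun_update q.1 (p q.1) q.2, q.1 (p q.1)).
have hK q : U q.1 -> h (h q) = q.
  case: q => f y /= Uf; rewrite /h /= pU //; congr (_, _); last first.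
    by rewrite ffunE eqxx.
  by apply/ffunP => z; rewrite !ffunE; case: eqP => // ->.
have pairE (F : {ffun D -> T} -> T -> nat) :
    (\sum_(f | U f) \sum_y F f y = \sum_(q | U q.1) F q.1 q.2)%N.
  by rewrite pair_big; apply: eq_bigl => q; rewrite andbT.
have -> : (\sum_(f | U f) #|S f| = \sum_(q | U q.1) S q.1 q.2)%N.
  rewrite -(pairE (fun f y => S f y : nat)).
  by apply: eq_bigr => f _; rewrite -sum1_card big_mkcond.
(* After the swap the summand tests [S f] at [f (p f)] and no longer involves [y]; summing over [y]
   gives the factor [#|T|]. *)
rewrite (reindex_onto h h) /=; last by move=> q; exact: hK.
under eq_bigl => q.
  have -> : U (ffun_update q.1 (p q.1) q.2) && (h (h q) == q) = U q.1.
    apply/andP/idP => [[Uq /eqP /(congr1 fst) /= qK]|Uq]; last by rewrite UU ?hK.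
    by rewrite -qK; exact: UU.
  over.
under eq_bigr => q Uq do rewrite SU //.
rewrite -(pairE (fun f _ => S f (f (p f)) : nat)).
under eq_bigr do rewrite sum_nat_const.
by rewrite -big_distrr /= -[in X in (_ * X = _)%N]sum1_card big_mkcondr.
Qed.

Lemma cyclic_iter_or_uniq (T : finType) (f : T -> T) (k : nat) (z : T) :
  uniq (traject f z k.+1) \/
  exists2 j, (j < #|T|)%N &
    uniq (traject f (iter k f z) j.+1)
      && (iter j.+1 f (iter k f z) == iter k f z).
Proof.
have [|] := boolP (uniq _); [by left|rewrite looping_uniq negbK => loop]; right.
set x := iter k f z.
have /trajectP[i ltik xi] := loop.
have cyc : exists m, iter m.+1 f x = x.
  exists (k - i).-1; rewrite prednK ?subn_gt0 //.
  by rewrite [in LHS]/x xi -iterD subnK ?(ltnW ltik).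
(* A return after some positive number of steps gives a return after exactly [order f x] steps. *)
have /= := (@orbitPcycle T f x 3 4).1 cyc => ordx.
have : uniq (orbit f x) && (iter (order f x) f x == x).
  by rewrite orbit_uniq ordx eqxx.
rewrite /orbit -{1 2}(prednK (order_gt0 f x)).
by exists (order f x).-1; rewrite // prednK ?order_gt0 ?max_card.
Qed.

(** * Counting simple paths and cycles *)

Section PathCounting.
Variable n : nat.
Implicit Types (delta : automaton n) (x z : 'I_n).

Definition act (c : letter) delta x : 'I_n := delta (x, c).

Definition simple_path (c : letter) x j delta :=
  uniq (traject (act c delta) x j.+1).

(** The index [j] counts the steps before the closing one, so [j = 0] is a fixed point. *)
Definition cycle_at (c : letter) x j delta :=
  simple_path c x j delta && (iter j.+1 (act c delta) x == x).

(** The first [j] steps read [delta] only at earlier vertices, all different from the endpoint,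
    where the value changes. Hence [card_resample] applies with the endpoint as [p]. *)
Lemma iter_act_update c delta x j y i :
  simple_path c x j delta -> (i <= j)%N ->
  iter i (act c (ffun_update delta (iter j (act c delta) x, c) y)) x =
  iter i (act c delta) x.
Proof.
move=> sp; elim: i => // i IH ij; rewrite !iterS IH ?(ltnW ij) //.
rewrite /act ffunE xpair_eqE eqxx andbT ifN_eq //.
apply: contraTneq sp => eqij.
rewrite /simple_path looping_uniq negbK.
by apply/trajectP; exists i.
Qed.

Lemma traject_act_update c delta x j y :
  simple_path c x j delta ->
  traject (act c (ffun_update delta (iter j (act c delta) x, c) y)) x j.+1 =
  traject (act c delta) x j.+1.
Proof.
move=> sp; apply: (@eq_from_nth _ x); rewrite !size_traject // => i lti.
by rewrite !nth_traject // iter_act_update.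
Qed.

Lemma card_simple_path0 c x : #|simple_path c x 0%N| = #|automaton n|.
Proof. exact: eq_card. Qed.

(** Given a simple path, the image of its endpoint is uniform, and only the value [x] closes the
    cycle. *)
Lemma card_cycle_at c x j :
  (n * #|cycle_at c x j| = #|simple_path c x j|)%N.
Proof.
pose p delta := (iter j (act c delta) x, c).
have := @card_resample _ _ (simple_path c x j) p (fun=> pred1 x).
rewrite card_ord => ->; first by under eq_bigr do rewrite card1; rewrite sum1_card.
- by move=> f y sp; rewrite /simple_path traject_act_update.
- by move=> f y sp; rewrite /p iter_act_update.
- by [].
Qed.

(** The uniform image of the endpoint must avoid the [j.+1] distinct vertices already visited. *)
Lemma card_simple_pathS (R : realType) c x j :
  n%:R * #|simple_path c x j.+1|%:R
    = (n%:R - j.+1%:R) * #|simple_path c x j|%:R :> R.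
Proof.
pose p delta := (iter j (act c delta) x, c).
pose S delta := [pred z | z \notin traject (act c delta) x j.+1].
have -> : #|simple_path c x j.+1| =
    #|[pred f | simple_path c x j f && S f (f (p f))]|.
  apply: eq_card => f.
  by rewrite unfold_in /simple_path trajectSr rcons_uniq andbC.
have := @card_resample _ _ (simple_path c x j) p S.
rewrite card_ord -natrM => ->; first last.
- by move=> f y sp z; rewrite /S traject_act_update.
- by move=> f y sp; rewrite /p iter_act_update.
- by move=> f y sp; rewrite /simple_path traject_act_update.
rewrite natr_sum (eq_bigr (fun=> n%:R - j.+1%:R)) => [|f sp].
  by rewrite sumr_const mulr_natr.
have /card_uniqP := sp; rewrite size_traject => card_path.
by rewrite -[in RHS](card_ord n) -(cardC (mem (traject (act c f) x j.+1)))
  natrD card_path addrAC subrr add0r.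
Qed.

(** The bound is a sum of indicators, so its expectation can be taken term by term. *)
Lemma card_delta_set_power c delta k :
  (#|delta_set delta (nseq k c) [set: 'I_n]| <=
   \sum_x \sum_(j < n) cycle_at c x j delta
   + \sum_z simple_path c z k delta)%N.
Proof.
set f := act c delta.
have word z : delta_word delta (nseq k c) z = iter k f z.
  by elim: k z => // k IH z; rewrite iterSr -IH.
pose C := [set x | [exists j : 'I_n, cycle_at c x j delta]].
pose V := [set z | simple_path c z k delta].
have sub : delta_set delta (nseq k c) [set: 'I_n] \subset
    C :|: [set iter k f z | z in V].
  apply/fintype.subsetP => _ /imsetP[z _ ->]; rewrite word inE.
  have [sp|[j]] := cyclic_iter_or_uniq f k z.
    by rewrite imset_f ?orbT // inE.
  rewrite card_ord => ltj cyc; apply/orP; left; rewrite inE.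
  by apply/existsP; exists (Ordinal ltj).
apply: (leq_trans (subset_leq_card sub)).
apply: (leq_trans (leq_card_setU _ _)).
apply: leq_add; last first.
  by rewrite (leq_trans (leq_imset_card _ _)) // cardsE -sum1_card big_mkcond.
rewrite cardsE -sum1_card big_mkcond leq_sum // => x _.
case: ifP => // /existsP[j cyc].
by rewrite (bigD1 j) //= [cycle_at _ _ _ _]cyc.
Qed.

End PathCounting.

(** * Estimates from the recurrence for the path probabilities *)

Section PathProbability.
Variables (R : realType) (n : nat) (u : nat -> R).
Hypothesis n_gt0 : (0 < n)%N.
Hypothesis u0 : u 0%N = 1.
Hypothesis u_ge0 : forall j, 0 <= u j.
Hypothesis uS : forall j, u j.+1 = u j * (1 - j.+1%:R / n%:R).

Lemma path_probability_decr j : u j.+1 <= u j.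
Proof.
rewrite uS ler_piMr // lerBlDr lerDl divr_ge0 //.
Qed.

Lemma path_probability_le1 j : u j <= 1.
Proof.
by elim: j => [|j IH]; rewrite ?u0 // (le_trans (path_probability_decr j)).
Qed.

(* Terms with j + 1 <= sqrt n are bounded by 1; for the others
   (j + 1) u_j = n (u_j - u_(j+1)) makes the sum telescope. *)
Lemma sum_path_probability J : \sum_(j < J) u j <= 2 * Num.sqrt n%:R.
Proof.
set s := Num.sqrt n%:R.
have s_gt0 : 0 < s by rewrite sqrtr_gt0 ltr0n.
have ss : s * s = n%:R by rewrite -expr2 sqr_sqrtr.
(* Strengthened for induction: the minimum counts the terms bounded by 1, and [s * (1 - u J)] pays
   for the telescoping ones. *)
suff bound : \sum_(j < J) u j <= Num.min J%:R s + s * (1 - u J).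
  apply: (le_trans bound); rewrite mulrDl !mul1r lerD ?ge_min ?lexx ?orbT //.
  by rewrite ler_piMr ?(ltW s_gt0) // lerBlDr lerDl.
elim: J => [|J IH]; first by rewrite big_ord0 u0 subrr mulr0 addr0 le_min lexx ltW.
rewrite big_ord_recr /=.
have tele : s * (s * (u J - u J.+1)) = J.+1%:R * u J.
  rewrite mulrA ss uS; field.
  by rewrite pnatr_eq0 -lt0n.
have [leJs|ltsJ] := leP (J.+1%:R) s.
  rewrite -natr1.
  have minJ : Num.min J%:R s <= J%:R by rewrite ge_min lexx.
  have := path_probability_le1 J; have := path_probability_decr J.
  rewrite -subr_ge0 => /(mulr_ge0 (ltW s_gt0)); lra.
have minS : Num.min J%:R s <= s by rewrite ge_min lexx orbT.
have : u J <= s * (u J - u J.+1).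
  by rewrite -(ler_pM2l s_gt0) tele ler_wpM2r // ltW.
lra.
Qed.

(** Each factor satisfies [1 - t <= expR (- t)]; the exponents add up to [j (j + 1) / 2n], relaxed
    to [j^2 / 2n]. *)
Lemma path_probability_exp j : u j <= expR (- (j%:R ^+ 2 / (2 * n%:R))).
Proof.
have nN0 : n%:R != 0 :> R by rewrite pnatr_eq0 -lt0n.
elim: j => [|j IH]; first by rewrite u0 expr0n mul0r oppr0 expR0.
rewrite uS; apply: (@le_trans _ _ (u j * expR (- (j.+1%:R / n%:R)))).
  by rewrite ler_wpM2l // expR_ge1Dx.
apply: (le_trans (ler_wpM2r (expR_ge0 _) IH)).
rewrite -expRD ler_expR -opprD lerN2 -natr1.
rewrite -subr_ge0 (_ : _ - _ = (2 * n%:R)^-1); last by field.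
by rewrite invr_ge0.
Qed.

Lemma path_probability_k_of : n%:R * u (k_of R n) <= 1.
Proof.
have n0 : 0 < n%:R :> R by rewrite ltr0n.
have n1 : 1 <= n%:R :> R by rewrite ler1n.
have ln0 : 0 <= ln (n%:R : R) by rewrite ln_ge0.
set t := 2 * Num.sqrt (n%:R * ln (n%:R : R)).
have t0 : 0 <= t by rewrite mulr_ge0 // sqrtr_ge0.
have tk : t <= (k_of R n)%:R.
  rewrite /k_of -/t pmulrn gez0_abs; first exact: ceil_ge.
  by rewrite -(ler_int R) (le_trans t0) // ceil_ge.
have t2 : t ^+ 2 = 4 * n%:R * ln (n%:R : R).
  rewrite exprMn sqr_sqrtr; first by ring.
  by rewrite mulr_ge0 // ltW.
(* The choice of [k] allows the exponent [2 ln n]; the weaker [ln n] already gives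
   [u k <= 1 / n]. *)
apply: (@le_trans _ _ (n%:R * expR (- ln n%:R))); last first.
  by rewrite expRN lnK ?posrE // divff // gt_eqF.
rewrite ler_pM2l // (le_trans (path_probability_exp _)) // ler_expR lerN2.
rewrite ler_pdivlMr ?mulr_gt0 //.
apply: (@le_trans _ _ (t ^+ 2)); last by rewrite ler_sqr ?nnegrE.
rewrite t2; have := mulr_ge0 (ltW n0) ln0; lra.
Qed.

End PathProbability.

(** * From counts to the expectation and its asymptotics *)

Lemma expected_a_reachable (R : realType) (n : nat) : (0 < n)%N ->
  unif_expectation (fun delta : automaton n => #|a_reachable R delta|%:R)
    <= 2 * Num.sqrt n%:R + 1 :> R.
Proof.
move=> n_gt0; set k := k_of R n.
have nN0 : n%:R != 0 :> R by rewrite pnatr_eq0 -lt0n.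
have N_gt0 : (0 < #|automaton n|)%N.
  by rewrite card_ffun card_ord expn_gt0 n_gt0.
set N : R := #|automaton n|%:R.
have NN0 : N != 0 by rewrite pnatr_eq0 -lt0n.
pose c := letter_a.
pose x0 : 'I_n := Ordinal n_gt0.
pose u (x : 'I_n) j : R := #|simple_path c x j|%:R / N.
have u0 x : u x 0%N = 1 by rewrite /u card_simple_path0 divff.
have uS x j : u x j.+1 = u x j * (1 - j.+1%:R / n%:R).
  apply: (mulfI nN0); rewrite /u mulrA card_simple_pathS.
  by field; rewrite nN0.
have u_ge0 x j : 0 <= u x j by rewrite divr_ge0.
(* The recurrence and the initial value do not depend on the starting state, so [x0] can represent
   all of them. *)
have ux x j : u x j = u x0 j by elim: j => [|j IH]; rewrite ?u0 // !uS IH.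
have cycE (x : 'I_n) j : #|cycle_at c x j|%:R / N = u x0 j / n%:R.
  rewrite -(ux x) /u -(card_cycle_at c x j) natrM.
  by field; rewrite nN0.
apply: (@le_trans _ _ (\sum_(j < n) u x0 j + n%:R * u x0 k)); last first.
  apply: lerD; first exact: sum_path_probability.
  exact: path_probability_k_of.
rewrite /unif_expectation -/N.
have -> : \sum_(j < n) u x0 j + n%:R * u x0 k =
    (\sum_(delta : automaton n)
      (\sum_x \sum_(j < n) cycle_at c x j delta
       + \sum_z simple_path c z k delta)%N%:R) / N.
  rewrite -natr_sum big_split /= natrD mulrDl; congr (_ + _).
    apply/esym; rewrite exchange_big natr_sum mulr_suml.
    rewrite (eq_bigr (fun=> (\sum_(j < n) u x0 j) / n%:R)) => [|x _].
      by rewrite sumr_const card_ord -[LHS]mulr_natr divfK.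
    rewrite exchange_big natr_sum !mulr_suml; apply: eq_bigr => j _.
    by rewrite -(cycE x) -sum1_card [in RHS]big_mkcond.
  apply/esym; rewrite exchange_big natr_sum mulr_suml.
  rewrite (eq_bigr (fun=> u x0 k)) => [|z _].
    by rewrite sumr_const card_ord mulr_natl.
  by rewrite -(ux z) /u -sum1_card [in RHS]big_mkcond.
rewrite ler_wpM2r ?invr_ge0 // ler_sum // => delta _.
by rewrite ler_nat card_delta_set_power.
Qed.

Local Open Scope classical_set_scope.

Theorem theorem1p1 (R : realType) :
  exists e : nat -> R,
    (e n @[n --> \oo] --> (0 : R)) /\
    (\forall n \near \oo,
      unif_expectation (fun delta : automaton n => #|a_reachable R delta|%:R)
        <= (1 + e n) * Num.sqrt (2 * pi * n%:R)).
Proof.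
(* With [s] the root of [n], this error turns [2 s] into [2 s + 2], which absorbs the additive 1. *)
exists (fun n => (Num.sqrt n%:R)^-1); split.
  apply/gtr0_cvgV0.
    by near=> n; rewrite sqrtr_gt0 ltr0n; near: n; exact: nbhs_infty_gt.
  apply/cvgryPge => A; near=> n.
  rewrite (le_trans (ler_norm A)) // -sqrtr_sqr ler_sqrt //.
  by near: n; exact: nbhs_infty_ger.
near=> n.
have n_gt0 : (0 < n)%N by near: n; exact: nbhs_infty_gt.
apply: (le_trans (expected_a_reachable R n_gt0)).
set s := Num.sqrt n%:R.
have s_gt0 : 0 < s by rewrite sqrtr_gt0 ltr0n.
(* After squaring, this is [4 <= 2 * pi]. *)
have s2 : 2 * s <= Num.sqrt (2 * pi * n%:R).
  rewrite -(ler_sqr (_ : 2 * s \is Num.nneg)) ?nnegrE ?sqrtr_ge0 //; last first.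
    by rewrite mulr_ge0 // ltW.
  have pi2 := pi_ge2 R.
  rewrite exprMn !sqr_sqrtr ?mulr_ge0 ?pi_ge0 //.
  by rewrite ler_wpM2r //; lra.
apply: (@le_trans _ _ ((1 + s^-1) * (2 * s))).
  by rewrite [leRHS]mulrDl mul1r lerD2l mulrCA mulVf ?gt_eqF // mulr1; lra.
by rewrite ler_wpM2l // addr_ge0 // invr_ge0 ltW.
Unshelve. all: by end_near.
Qed.
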